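(* Let $p$ be a prime, let $\mathcal E$ be a semisaturated fusion system on a finite $p$-group $P$ and let $Q$ be a fully normalized $\mathcal E$-essential subgroup of $P$. Then the following hold: (a) $Q$ is $\mathcal E$-centric. (b) Let $H=\langle\phi\in\mathrm{Out}_{\mathcal E}(Q)\mid \mathrm{Out}_P(Q)\cap\mathrm{Out}_P(Q)^\phi>1\rangle$. Then $H$ is strongly $\mathrm{Out}_P(Q)$-embedded in $\mathrm{Out}_{\mathcal E}(Q)$. Moreover, $\mathrm{Out}_P(Q)\cap O_p(\mathrm{Out}_{\mathcal E}(Q))=1$. (c) $\mathrm{Inn}(Q)=\mathrm{Core}_G(D)$ where $G=\mathrm{Aut}_{\mathcal E}(Q)$ and $D=\mathrm{Aut}_P(Q)$.
   Context: All groups are finite and maps are written on the right. Fusion systems and saturated fusion systems on finite $p$-groups are understood in the standard sense. Semisaturated: a fusion system $\mathcal E$ on a $p$-group $P$ is semisaturated if there exist a $p$-group $S\ge P$ and a saturated fusion system $\mathcal F\ge\mathcal E$ on $S$ such that $P$ is strongly $\mathcal F$-closed (i.e. $x\phi\in P$ for all $x\in P$, $\phi\in\mathrm{Hom}_{\mathcal F}(\langle x\rangle,S)$) and $\mathcal E=\mathcal F_{|\le P}$, i.e. $\mathrm{Hom}_{\mathcal E}(A,B)=\mathrm{Hom}_{\mathcal F}(A,B)$ for all $A,B\le P$. For a fusion system $\mathcal E$ on $P$: $Q^{\mathcal E}$ denotes the set of $\mathcal E$-conjugates of $Q$; $c_x$ denotes conjugation by $x$. $Q\le P$ is fully ($\mathcal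 E$-)normalized if $|N_P(Q)|\ge|N_P(R)|$ for all $R\in Q^{\mathcal E}$, and $\mathcal E$-centric if $C_P(R)\le R$ for all $R\in Q^{\mathcal E}$. For $\phi\in\mathrm{Hom}_{\mathcal E}(Q,P)$, put $$N_\phi(Q)=\{x\in N_P(Q)\mid \exists\, y\in N_P(Q\phi)\text{ such that }\phi^{-1}c_x\phi=c_y\text{ on }Q\phi\}.$$ $Q$ is receptive if every $\mathcal E$-isomorphism $\phi:R\to Q$ extends to some $\overline\phi\in\mathrm{Hom}_{\mathcal E}(N_\phi(R),P)$. A proper subgroup $R<P$ is reproductive if $R$ is receptive and for each $Q\in R^{\mathcal E}$ there exists $\psi\in\mathrm{Hom}_{\mathcal E}(Q,R)$ with $N_\psi(Q)>Q$. $Q$ is $\mathcal E$-essential if $Q$ is reproductive and $\langle\phi\in\mathrm{Aut}_{\mathcal E}(Q)\mid N_\phi(Q)>Q\rangle$ is proper in $\mathrm{Aut}_{\mathcal E}(Q)$. $\mathrm{Aut}_P(Q)$ is the group of automorphisms of $Q$ induced by conjugation by elements of $N_P(Q)$; $\mathrm{Out}_{\mathcal E}(Q)=\mathrm{Aut}_{\mathcal E}(Q)/\mathrm{Inn}(Q)$ and $\mathrm{Out}_P(Q)=\mathrm{Aut}_P(Q)/\mathrm{Inn}(Q)$. For $D\le T\le G$, $D$ is strongly closed in $T$ with respect to $G$ if $x^g\in D$ whenever $x\in D$, $g\in G$ and $x^g\in T$. If $T\in\mathrm{Syl}_p(G)$ and $D>1$ is strongly closed in $T$ with respect to $G$, a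 proper subgroup $H<G$ is strongly $D$-embedded in $G$ if (i) $D^x\le H$ for some $x\in G$; (ii) for all $g\in G\setminus H$, $H\cap H^g$ contains no $G$-conjugate of any nontrivial subgroup $U$ of $D$. $\mathrm{Core}_G(D)=\bigcap_{g\in G}D^g$. *)

(* Defs.v *)
From mathcomp Require Import all_boot all_fingroup all_solvable.

Set Implicit Arguments.
Unset Strict Implicit.
Unset Printing Implicit Defensive.

Local Open Scope group_scope.

(* A morphism A -> B is represented by a function gT -> gT of which only the
   values on A matter (fhom_ext), so that restriction and enlargement of the
   codomain do not change the underlying function. Conjugation y ^ x is
   x^-1 * y * x, and permutations compose from left to right, so all maps are
   effectively written on the right. *)
Record fusion_system (gT : finGroupType) (P : {group gT}) := FusionSystem {
  fhom : {group gT} -> {group gT} -> (gT -> gT) -> bool;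
  fhom_ext : forall (A B : {group gT}) (f g : gT -> gT),
    {in A, f =1 g} -> fhom A B f -> fhom A B g;
  fhom_sub : forall (A B : {group gT}) (f : gT -> gT),
    fhom A B f -> A \subset P /\ B \subset P;
  fhom_mono : forall (A B : {group gT}) (f : gT -> gT), fhom A B f ->
    [/\ {in A &, {morph f : x y / x * y}}, {in A &, injective f}
      & f @: A \subset B];
  fhom_conj : forall (A B : {group gT}) (x : gT),
    A \subset P -> B \subset P -> x \in P -> A :^ x \subset B ->
    fhom A B (conjg^~ x);
  fhom_comp : forall (A B C : {group gT}) (f g : gT -> gT),
    fhom A B f -> fhom B C g -> fhom A C (g \o f);
  (* every morphism is an isomorphism of the system onto its image, followed
     by an inclusion *)
  fhom_iso : forall (A B C : {group gT}) (f : gT -> gT),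
    fhom A B f -> f @: A = C ->
    fhom A C f /\ exists2 g : gT -> gT, fhom C A g & {in A, cancel f g}
}.

Section LocalNotions.

Variables (gT : finGroupType) (P : {group gT}).
Implicit Types (Q R : {group gT}) (f : gT -> gT).

Definition Nphi Q f : {set gT} :=
  [set x in 'N_P(Q) | [exists y in 'N_P(f @: Q),
     [forall q in Q, f (q ^ x) == f q ^ y]]].

Lemma Nphi_group_set Q f : group_set (Nphi Q f).
Proof.
apply/group_setP; split=> [|x1 x2].
  rewrite inE group1; apply/exists_inP; exists 1; first exact: group1.
  by apply/forall_inP=> q _; rewrite !conjg1.
case/setIdP=> Nx1 /exists_inP[y1 Ny1 /forall_inP fy1].
case/setIdP=> Nx2 /exists_inP[y2 Ny2 /forall_inP fy2].
rewrite inE groupM //; apply/exists_inP; exists (y1 * y2); first exact: groupM.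
apply/forall_inP=> q Qq; rewrite !conjgM -(eqP (fy1 _ Qq)).
by apply: fy2; rewrite memJ_norm //; case/setIP: Nx1.
Qed.

Canonical Nphi_group Q f := Group (Nphi_group_set Q f).

Definition AutP Q : {set {perm gT}} := conj_aut Q @* 'N_P(Q).
Canonical AutP_group Q := Eval hnf in [group of AutP Q].

Definition Inn Q : {set {perm gT}} := conj_aut Q @* Q.
Canonical Inn_group Q := Eval hnf in [group of Inn Q].

Definition OutP Q := AutP Q / Inn Q.
Canonical OutP_group Q := Eval hnf in [group of OutP Q].

Variable E : fusion_system P.

Definition AutE Q : {set {perm gT}} := [set a in Aut Q | fhom E Q Q a].

Lemma AutE_group_set Q : Q \subset P -> group_set (AutE Q).
Proof.
move=> sQP; apply/group_setP; split=> [|a b].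
  rewrite inE group1; apply: (@fhom_ext _ _ E _ _ (conjg^~ 1)).
    by move=> x _; rewrite conjg1 perm1.
  by apply: fhom_conj; rewrite ?group1 ?conjsg1.
case/setIdP=> Aa Ea /setIdP[Ab Eb]; rewrite inE groupM //.
apply: (@fhom_ext _ _ E _ _ (b \o a)); last exact: fhom_comp Ea Eb.
by move=> x _; rewrite permM.
Qed.

Definition OutE Q := AutE Q / Inn Q.

Definition isoE Q R f := fhom E Q R f /\ f @: Q = R.

Definition conjugateE Q R := exists f, isoE Q R f.

Definition fully_normalized Q :=
  Q \subset P /\ forall R, conjugateE Q R -> #|'N_P(R)| <= #|'N_P(Q)|.

Definition centricE Q :=
  Q \subset P /\ forall R, conjugateE Q R -> 'C_P(R) \subset R.

Definition receptive Q :=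
  Q \subset P /\ forall R f, isoE R Q f ->
    exists2 h : gT -> gT, fhom E (Nphi_group R f) P h & {in R, h =1 f}.

Definition reproductive R :=
  [/\ R \proper P, receptive R
    & forall Q, conjugateE R Q ->
        exists2 f : gT -> gT, fhom E Q R f & Q \proper Nphi Q f].

Definition essential Q :=
  reproductive Q /\ <<[set a in AutE Q | Q \proper Nphi Q a]>> \proper AutE Q.

Definition strongly_closedE (D : {group gT}) :=
  D \subset P /\ forall x f, x \in D -> fhom E <[x]>%G P f -> f x \in D.

Definition fully_automized (p : nat) Q := p.-Sylow(AutE Q) (AutP Q).

Definition saturated (p : nat) :=
  p.-group P /\ forall Q, Q \subset P ->
    exists R, [/\ conjugateE Q R, fully_automized p R & receptive R].

End LocalNotions.

(* The overgroup S >= P may live in another finGroupType, so the inclusion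
   of P in S is an injective morphism iota. Every F-morphism between subgroups
   of iota @* P has the form g below for some f, and conversely. *)
Definition semisaturated (gT : finGroupType) (P : {group gT}) (p : nat)
    (E : fusion_system P) : Prop :=
  exists (hT : finGroupType) (S : {group hT}) (F : fusion_system S)
         (iota : {morphism P >-> hT}),
  [/\ 'injm iota, iota @* P \subset S, saturated F p,
      strongly_closedE F (iota @* P)%G
    & forall (A B : {group gT}) (f : gT -> gT) (g : hT -> hT),
        A \subset P -> B \subset P ->
        {in A, forall x, f x \in B /\ g (iota x) = iota (f x)} ->
        fhom E A B f = fhom F (iota @* A)%G (iota @* B)%G g].

Section StronglyEmbedded.

Variable gT : finGroupType.
Implicit Types D T G H : {set gT}.

Definition strongly_closed_in D T G :=
  [/\ D \subset T, T \subset G &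
      forall x g, x \in D -> g \in G -> x ^ g \in T -> x ^ g \in D].

Definition strongly_embedded (p : nat) (G D H : {set gT}) : Prop :=
  [/\ (exists2 T : {group gT}, T \in 'Syl_p(G) & strongly_closed_in D T G),
      D :!=: 1,
      H \proper G,
      (exists2 x, x \in G & D :^ x \subset H)
    & forall (U : {group gT}) (g x : gT),
        g \in G :\: H -> U \subset D -> U :!=: 1 -> x \in G ->
        ~ (U :^ x \subset H :&: H :^ g)].

End StronglyEmbedded.

(* Main.v *)
Require Import Defs.
From mathcomp Require Import all_boot all_fingroup all_solvable.

(* Write E as the restriction of a saturated system F on S to P, and let R be an
   F-conjugate of Q which is fully automized and receptive in F. As P is
   strongly closed and Q is fully normalized, Q can be mapped to R such that
   N_P(Q) goes onto N_P(R); pulling Aut_S(R) back yields a Sylow subgroup T of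
   G = Aut_E(Q) in which D = Aut_P(Q) is strongly closed with respect to G.
   If C_P(Q) were not contained in Q, then N_phi(Q) > Q for all phi in G, which
   essentiality excludes. Hence N_phi(Q) > Q as soon as D and D^phi meet outside
   Inn(Q), so H is proper in Out_E(Q). If D is strongly closed in a Sylow
   subgroup T and H = < g | D and D^g meet nontrivially > is proper, then
   T <= N(D) <= H, so by Sylow's theorem in H every p-subgroup of H that is
   conjugate to a subgroup of D is already H-conjugate to one; this gives strong
   embedding. *)

Set Implicit Arguments.
Unset Strict Implicit.
Unset Printing Implicit Defensive.
Local Open Scope group_scope.

(** * Strongly closed subgroups and strong embedding in a group *)

Section GroupTheory.

Variables (gT : finGroupType) (p : nat).
Implicit Types D T G H N : {group gT}.

Lemma strongly_closed_norm D T G :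
  strongly_closed_in D T G -> T \subset 'N(D).
Proof.
case=> sDT sTG scD; apply/subsetP=> t Tt; rewrite inE.
apply/subsetP=> _ /imsetP[x Dx ->].
by apply: scD; [| apply: subsetP Tt | rewrite groupJ // (subsetP sDT)].
Qed.

(** As N <= T, a conjugate d^g lies in T as soon as its coset lies in T / N, so strong closure of D
    applies to d^g itself. *)
Lemma strongly_closed_quotient D T G N :
  N <| G -> N \subset T -> strongly_closed_in D T G ->
  strongly_closed_in (D / N) (T / N) (G / N).
Proof.
case/andP=> sNG nNG sNT [sDT sTG scD]; split; rewrite ?quotientS //.
move=> _ _ /morphimP[d nNd Dd ->] /morphimP[g nNg Gg ->].
rewrite -morphJ // => /morphimP[t nNt Tt eq_dt].
have Tdg : d ^ g \in T.
  have: d ^ g \in N :* t by apply/rcoset_kercosetP; rewrite ?groupJ.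
  by case/rcosetP=> n Nn ->; rewrite groupM // (subsetP sNT).
exact: mem_quotient (scD _ _ Dd Gg Tdg).
Qed.

Lemma strongly_embedded_gen (D T G : {group gT}) :
    p.-Sylow(G) T -> strongly_closed_in D T G -> D :!=: 1 ->
    let H := <<[set g in G | D :&: D :^ g != 1]>> in
    H \proper G -> strongly_embedded p G D H /\ D :&: 'O_p(G) = 1.
Proof.
move=> sylT scDT ntD H prH.
have [sDT sTG scD] := scDT; have nDT := strongly_closed_norm scDT.
have memH g : g \in G -> D :&: D :^ g != 1 -> g \in H.
  by move=> Gg ntDg; rewrite mem_gen // inE Gg.
have sTH : T \subset H.
  apply/subsetP=> t Tt; apply: memH; first exact: subsetP Tt.
  by rewrite (normsP nDT) // setIid.
have sHG := proper_sub prH.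
have sylTH : p.-Sylow(H) T := pHall_subl sTH sHG sylT.
(* Sylow's theorem in H moves U^x into T; the elements reached are G-conjugates of elements of D
   lying in T, hence lie in D. *)
have intoD (U : {group gT}) x : U \subset D -> x \in G -> U :^ x \subset H ->
    exists2 h, h \in H & U :^ (x * h) \subset D.
  move=> sUD Gx sUH; have pU : p.-group (U :^ x).
    by rewrite pgroupJ (pgroupS _ (pHall_pgroup sylT)) // (subset_trans sUD).
  have [h Hh sUT] := Sylow_Jsub sylTH sUH pU; exists h => //.
  rewrite conjsgM; apply/subsetP=> _ /imsetP[_ /imsetP[u Uu ->] ->].
  rewrite -conjgM; apply: scD; rewrite ?(subsetP sUD) //.
    by rewrite groupM // (subsetP sHG).
  by rewrite conjgM (subsetP sUT) // !memJ_conjg.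
split; first split=> //.
- by exists T; first rewrite inE.
- by exists 1; rewrite ?conjsg1 ?(subset_trans sDT).
- move=> U g x /setDP[Gg notHg] sUD ntU Gx; rewrite subsetI => /andP[sUH sUHg].
  have [h Hh sUhD] := intoD U x sUD Gx sUH.
  have [||k Hk sUkD] := intoD U (x * g^-1) sUD.
  - by rewrite groupM ?groupV.
  - by rewrite conjsgM sub_conjgV.
  (* This element m carries U^(x h) to U^(x g^-1 k). Both lie in D, so D meets D^m nontrivially; and
     m in H forces g in H. *)
  have Hm : h^-1 * g^-1 * k \in H.
    apply: memH.
      by rewrite !groupM ?groupV // (subsetP sHG).
    apply: contraNneq ntU => trD.
    rewrite -subG1 -(conjSg _ _ (x * g^-1 * k)) conjs1g -trD subsetI sUkD.
    have ->: x * g^-1 * k = x * h * (h^-1 * g^-1 * k).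
      by rewrite !mulgA mulgK.
    by rewrite conjsgM conjSg.
  case/negP: notHg; rewrite -groupV.
  by move: Hm; rewrite groupMr // groupMl ?groupV.
(* O_p(G) is normal and contained in T, so by strong closure every D^g contains the intersection of
   D and O_p(G). If this is nontrivial, every g in G is a generator of H. *)
apply/eqP; apply: contraTT prH => ntN; rewrite properE sHG /= negbK.
apply/subsetP=> g Gg; apply: memH => //.
apply: contraNneq ntN => trDg; rewrite -subG1 -trDg subsetI subsetIl /=.
have sOT := pcore_sub_Hall sylT.
apply/subsetP=> x /setIP[Dx Ox]; rewrite mem_conjg.
apply: scD; rewrite ?groupV //; apply: (subsetP sOT).
by rewrite memJ_norm ?groupV // (subsetP (normal_norm (pcore_normal _ _))).
Qed.

End GroupTheory.

(** * Morphisms, the groups N_phi(Q), and Inn(Q) <= Aut_P(Q) <= Aut_E(Q) *)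

Section Fusion.

Variables (gT : finGroupType) (P : {group gT}) (E : fusion_system P).
Implicit Types (A B C Q R : {group gT}).

Lemma fhom_id A B : A \subset B -> B \subset P -> fhom E A B id.
Proof.
move=> sAB sBP; apply: (@fhom_ext _ _ E _ _ (conjg^~ 1)).
  by move=> x _ /=; rewrite conjg1.
by apply: fhom_conj; rewrite ?conjsg1 // (subset_trans sAB).
Qed.

Lemma fhom_restr A B C f : fhom E A B f -> C \subset A -> fhom E C B f.
Proof.
move=> Ef sCA; have [sAP _] := fhom_sub Ef.
exact: fhom_comp (fhom_id sCA sAP) Ef.
Qed.

Lemma Nphi_sub Q f : Nphi P Q f \subset 'N_P(Q).
Proof. by apply/subsetP=> x /setIdP[]. Qed.

Lemma centP_sub_Nphi Q f : 'C_P(Q) \subset Nphi P Q f.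
Proof.
apply/subsetP=> x /setIP[Px cQx].
rewrite inE inE Px (subsetP (cent_sub _)) //; apply/exists_inP; exists 1.
  exact: group1.
by apply/forall_inP=> q Qq; rewrite conjg1 (conjgE q) -(centP cQx _ Qq) mulKg.
Qed.

Lemma sub_Nphi Q R f : fhom E Q R f -> Q \subset Nphi P Q f.
Proof.
move=> Ef; have [sQP sRP] := fhom_sub Ef; have [fM _ sfR] := fhom_mono Ef.
have fJ := @morphJ _ _ _ (Morphism fM).
apply/subsetP=> x Qx; rewrite inE inE (subsetP sQP) // (subsetP (normG Q)) //.
apply/exists_inP; exists (f x); last by apply/forall_inP=> q Qq; rewrite -fJ.
rewrite inE (subsetP sRP) ?(subsetP sfR) ?imset_f //= inE.
apply/subsetP=> _ /imsetP[_ /imsetP[q Qq ->] ->].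
by rewrite -fJ // imset_f ?groupJ.
Qed.


Lemma fhom_widen A B C f : fhom E A B f -> B \subset C -> C \subset P ->
  fhom E A C f.
Proof. by move=> Ef sBC sCP; apply: fhom_comp Ef (fhom_id sBC sCP). Qed.

(** Restricting f to <x> and enlarging its codomain gives the only kind of morphism that
    [strongly_closedE] speaks of. *)
Lemma strongly_closed_fhom (D A B : {group gT}) f x :
  strongly_closedE E D -> fhom E A B f -> x \in A -> x \in D -> f x \in D.
Proof.
case=> _ scD Ef Ax Dx; apply: scD => //.
have [_ sBP] := fhom_sub Ef.
by apply: fhom_restr (fhom_widen Ef sBP (subxx P)) _; rewrite cycle_subG.
Qed.

(** Permutations in [Aut Q] fix all points outside Q, so agreement on Q suffices for equality. *)
Lemma AutPP Q a : a \in Aut Q ->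
  reflect (exists2 x, x \in 'N_P(Q) & {in Q, forall q, a q = q ^ x})
          (a \in AutP P Q).
Proof.
move=> Aa; apply: (iffP idP) => [/morphimP[x nQx NPx ->] | [x NPx def_a]].
  by exists x => // q Qq; apply: norm_conj_autE.
have [_ nQx] := setIP NPx; suffices ->: a = conj_aut Q x by apply: mem_morphim.
apply: eq_Aut Aa _ _ => [|q Qq]; first exact: Aut_aut.
by rewrite def_a //; apply/esym/norm_conj_autE.
Qed.

Lemma AutP_sub Q : Q \subset P -> AutP P Q \subset AutE E Q.
Proof.
move=> sQP; apply/subsetP=> a Da; have Aa := subsetP (Aut_conj_aut _ _) a Da.
rewrite inE Aa; have [x /setIP[Px nQx] def_a] := AutPP Aa Da.
apply: (@fhom_ext _ _ E _ _ (conjg^~ x)) => [q Qq |]; first by rewrite def_a.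
by apply: fhom_conj; rewrite // (normP nQx).
Qed.

Lemma Inn_sub_AutP Q : Q \subset P -> Inn Q \subset AutP P Q.
Proof. by move=> sQP; rewrite morphimS // subsetI sQP normG. Qed.

(** Conjugating c_x by a yields conjugation by [a x]. *)
Lemma Inn_normal Q : Q \subset P -> Inn Q <| AutE E Q.
Proof.
move=> sQP; have sIG := subset_trans (Inn_sub_AutP sQP) (AutP_sub sQP).
rewrite /normal sIG; apply/subsetP=> a /setIdP[Aa _]; rewrite inE.
apply/subsetP=> _ /imsetP[_ /morphimP[x nQx Qx ->] ->].
suffices ->: conj_aut Q x ^ a = conj_aut Q (a x).
  by apply: mem_morphim; rewrite ?(subsetP (normG Q)) // Aut_closed.
apply: (@eq_Aut _ Q) => [||q Qq]; first by rewrite groupJ ?Aut_aut.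
  exact: Aut_aut.
have [q' Qq' ->]: exists2 q', q' \in Q & q = a q'.
  by exists (a^-1 q); rewrite ?permKV // Aut_closed ?groupV.
rewrite permJ !conj_autE ?Aut_closed //.
exact: (morphJ (autm_morphism Aa)).
Qed.

End Fusion.

(** * Passage to the saturated system F and back *)

Section Transfer.

Variables (gT hT : finGroupType) (P : {group gT}) (S : {group hT}).
Variables (E : fusion_system P) (F : fusion_system S).
Variable iota : {morphism P >-> hT}.
Hypothesis injI : 'injm iota.
Hypothesis eqEF : forall (A B : {group gT}) (f : gT -> gT) (g : hT -> hT),
  A \subset P -> B \subset P ->
  {in A, forall x, f x \in B /\ g (iota x) = iota (f x)} ->
  fhom E A B f = fhom F (iota @* A)%G (iota @* B)%G g.

(** Theta is conjugation by the isomorphism of Q onto R given by iota followed by gamma. *)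
Lemma Aut_transfer (Q : {group gT}) (R : {group hT}) (gamma : hT -> hT) :
  Q \subset P -> isoE F (iota @* Q)%G R gamma ->
  exists Theta : {morphism Aut Q >-> {perm hT}},
    [/\ 'injm Theta, Theta @* Aut Q = Aut R, Theta @* AutE E Q = AutE F R
      & {in Aut Q & Q, forall a q,
           Theta a (gamma (iota q)) = gamma (iota (a q))}].
Proof.
move=> sQP [Fgam imgam]; have [gamM gamI _] := fhom_mono Fgam.
have Iq q : q \in Q -> iota q \in iota @* Q.
  by move=> Qq; rewrite mem_morphim ?(subsetP sQP).
have thM : {in Q &, {morph (gamma \o iota) : x y / x * y}}.
  by move=> x y Qx Qy /=; rewrite morphM ?(subsetP sQP) // gamM ?Iq.
pose theta := Morphism thM.
have injth : 'injm theta.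
  apply/injmP=> x y Qx Qy /= /gamI eq_xy.
  by apply: (injmP injI); rewrite ?(subsetP sQP) // eq_xy ?Iq.
have imth : theta @* Q = R.
  by rewrite morphimEdom /= imset_comp -imgam /= morphimEsub.
have ThE : {in Aut Q & Q, forall a q,
    Aut_isom injth (subxx Q) a (gamma (iota q)) = gamma (iota (a q))}.
  by move=> a q Aa Qq; apply: (Aut_isomE injth (subxx Q) Aa Qq).
exists (Aut_isom_morphism injth (subxx Q)).
have imAut := im_Aut_isom injth (subxx Q).
split=> //; [exact: injm_Aut_isom | by rewrite /= imAut imth |].
have [FgamR [delta Fdel gamK]] := fhom_iso Fgam imgam.
have mem_eq a : a \in Aut Q ->
    fhom E Q Q a = fhom F R R (Aut_isom injth (subxx Q) a).
  move=> Aa; set b := Aut_isom _ _ a.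
  (* On iota Q, the map a reads as gamma, then b, then the inverse delta of gamma; so a is in E
     exactly when b is in F. *)
  rewrite (@eqEF Q Q a (delta \o (b \o gamma))) //; last first.
    by move=> q Qq /=; rewrite Aut_closed // ThE // gamK ?Iq // Aut_closed.
  apply/idP/idP=> Fb; last exact: fhom_comp (fhom_comp Fgam Fb) Fdel.
  apply: (fhom_ext _ (fhom_comp (fhom_comp Fdel Fb) Fgam)) => r.
  rewrite -{1}imgam => /imsetP[_ /morphimP[q Pq Qq ->] ->] /=.
  by rewrite gamK ?Iq // ThE // gamK ?Iq // Aut_closed.
apply/setP=> b; apply/morphimP/idP=> [[a Aa /setIdP[_ Ea] ->] | /setIdP[Ab Fb]].
  by rewrite inE -mem_eq // Ea andbT -imth Aut_Aut_isom.
move: Ab; rewrite -imth -imAut => /morphimP[a _ Aa def_b].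
by exists a => //; rewrite inE Aa mem_eq // -def_b.
Qed.

End Transfer.

(** Under Theta, T corresponds to Aut_S(R), which is Sylow as R is fully automized, and Aut_P(Q) to
    Aut_I(R), where I is the image of P. Receptivity of R and strong closure of I make Aut_I(R)
    strongly closed. *)
Lemma semisaturated_Sylow (gT : finGroupType) (p : nat) (P : {group gT})
    (E : fusion_system P) (Q : {group gT}) :
    semisaturated p E -> fully_normalized E Q ->
  exists2 T : {group {perm gT}}, p.-Sylow(AutE E Q) T
    & strongly_closed_in (AutP P Q) T (AutE E Q).
Proof.
move=> [hT [S [F [iota [injI sIS [pS satF] scI eqEF]]]]] [sQP maxN].
set I := (iota @* P)%G in scI; have [sIS' _] := scI.
have pP : p.-group P by rewrite -(injm_pgroup injI _ (subxx P)) (pgroupS sIS).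
have sQS : iota @* Q \subset S := subset_trans (morphimS iota sQP) sIS.
have [R [[alpha [Falpha imalpha]] sylR [sRS recR]]] := satF (iota @* Q)%G sQS.
pose GF := Group (AutE_group_set F sRS); pose GE := Group (AutE_group_set E sQP).
have sDG : AutP P Q \subset GE := AutP_sub E sQP.
have sGA : GE \subset Aut Q by apply/subsetP=> a /setIdP[].
have nQx x : x \in 'N_P(Q) -> {in Q, forall q, q ^ x \in Q}.
  by move=> /setIP[_ nQx] q Qq; rewrite memJ_norm.
have Iq q : q \in Q -> iota q \in iota @* Q.
  by move=> Qq; rewrite mem_morphim ?(subsetP sQP).
have iotaJ x q : x \in P -> q \in Q -> iota (q ^ x) = iota q ^ iota x.
  by move=> Px Qq; rewrite morphJ // (subsetP sQP).
(* By Sylow, gamma can be chosen such that it carries Aut_P(Q) into Aut_S(R),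
   hence such that N_gamma contains N_P(Q). *)
have [gamma [Fgam imgam] conjgam] :
  exists2 gamma, isoE F (iota @* Q)%G R gamma
    & forall x, x \in 'N_P(Q) -> exists2 y, y \in 'N_S(R)
    & {in Q, forall q, gamma (iota (q ^ x)) = gamma (iota q) ^ y}.
  have [Theta [injTh _ imTh ThE]] :=
    Aut_transfer injI eqEF sQP (conj Falpha imalpha).
  have sThD : Theta @* AutP P Q \subset GF by rewrite -[gval GF]imTh morphimS.
  have pThD : p.-group (Theta @* AutP P Q).
    by rewrite morphim_pgroup // morphim_pgroup // (pgroupS (subsetIl _ _)).
  have [beta GFbeta sDbeta] := Sylow_Jsub (sylR : p.-Sylow(GF) _) sThD pThD.
  have [Abeta Fbeta] := setIdP GFbeta.
  exists (beta \o alpha).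
    split; first exact: fhom_comp Falpha Fbeta.
    rewrite imset_comp imalpha; apply/setP=> r; apply/imsetP/idP=> [[s Rs ->]|Rr].
      by rewrite Aut_closed.
    by exists (beta^-1 r); rewrite ?permKV // Aut_closed ?groupV.
  move=> x NPx; have [Px nx] := setIP NPx.
  have Dx : conj_aut Q x \in AutP P Q by rewrite mem_morphim.
  have Ax : conj_aut Q x \in Aut Q by apply: Aut_aut.
  have: Theta (conj_aut Q x) ^ beta \in AutP S R.
    by rewrite (subsetP sDbeta) // memJ_conjg mem_morphim.
  have AThx : Theta (conj_aut Q x) \in Aut R.
    have: Theta (conj_aut Q x) \in GF by rewrite (subsetP sThD) ?mem_morphim.
    by case/setIdP.
  case/AutPP=> [|y NSy def_y]; first by rewrite groupJ.
  exists y => // q Qq /=; have Raq : alpha (iota q) \in R.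
    by rewrite -imalpha imset_f ?Iq.
  rewrite -(norm_conj_autE nx Qq) -(ThE _ _ Ax Qq) -permJ def_y //.
  by rewrite Aut_closed.
have [Theta [injTh imThA imTh ThE]] :=
  Aut_transfer injI eqEF sQP (conj Fgam imgam).
have Rgam q : q \in Q -> gamma (iota q) \in R.
  by move=> Qq; rewrite -imgam imset_f ?Iq.
have Rpre r : r \in R -> exists2 q, q \in Q & r = gamma (iota q).
  by rewrite -{1}imgam => /imsetP[_ /morphimP[q _ Qq ->] ->]; exists q.
have gaminj : {in Q &, injective (gamma \o iota)}.
  have [_ gamI _] := fhom_mono Fgam.
  move=> x y Qx Qy /= /gamI eq_xy.
  by apply: (injmP injI); rewrite ?(subsetP sQP) // eq_xy ?Iq.
have sRI : R \subset I.
  apply/subsetP=> r /Rpre[q Qq ->].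
  apply: (strongly_closed_fhom scI Fgam); first exact: Iq.
  by rewrite mem_morphim ?(subsetP sQP).
have [h Fh def_h] := recR _ _ (conj Fgam imgam).
have [hM hinj _] := fhom_mono Fh.
have sQN := sub_Nphi Fgam.
have hE q : q \in Q -> h (iota q) = gamma (iota q) by move/Iq/def_h.
have Nx x : x \in 'N_P(Q) -> iota x \in Nphi S (iota @* Q)%G gamma.
  move=> NPx; have [Px nx] := setIP NPx.
  have [y NSy def_y] := conjgam x NPx.
  rewrite inE inE (subsetP sIS) ?mem_morphim //=.
  rewrite (subsetP (morphim_norm _ _)) ?mem_morphim //=.
  apply/exists_inP; exists y; first by rewrite imgam.
  by apply/forall_inP=> _ /morphimP[q _ Qq ->]; rewrite -iotaJ // def_y.
have hJ x q : x \in 'N_P(Q) -> q \in Q ->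
    gamma (iota q) ^ h (iota x) = gamma (iota (q ^ x)).
  move=> NPx Qq; have [Px nx] := setIP NPx.
  rewrite -!hE ?nQx // iotaJ //.
  apply/esym/(morphJ (Morphism hM)); last exact: Nx.
  exact: subsetP sQN _ (Iq _ Qq).
have sIR : [set h (iota x) | x in 'N_P(Q)] \subset 'N_I(R).
  apply/subsetP=> _ /imsetP[x NPx ->]; have [Px nx] := setIP NPx.
  rewrite inE (strongly_closed_fhom scI Fh) ?Nx ?mem_morphim //= inE.
  by apply/subsetP=> _ /imsetP[_ /Rpre[q Qq ->] ->]; rewrite hJ // Rgam ?nQx.
(* Equality by counting: the preimage R1 of R in P is an E-conjugate of Q, so full normalization of
   Q bounds |N_I(R)| = |N_P(R1)| by |N_P(Q)|, and h is injective. *)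
have NIR : [set h (iota x) | x in 'N_P(Q)] = 'N_I(R).
  apply/eqP; rewrite eqEcard sIR card_in_imset => [|x y NPx NPy /hinj eq_xy].
    pose R1 := (iota @*^-1 R)%G.
    have imR1 : iota @* R1 = R by rewrite /= morphpreK.
    have sR1P : R1 \subset P by apply: subsetIl.
    have -> : #|'N_I(R)| = #|'N_P(R1)|.
      by rewrite -imR1 -injm_subnorm // card_injm ?subsetIl.
    apply: maxN; exists (invm injI \o (gamma \o iota)).
    have iotaK q : q \in Q -> iota (invm injI (gamma (iota q))) = gamma (iota q).
      by move=> Qq; rewrite invmK // (subsetP sRI) ?Rgam.
    have R1q q : q \in Q -> invm injI (gamma (iota q)) \in R1.
      move=> Qq; have /morphimP[x Px _ def_x] := subsetP sRI _ (Rgam q Qq).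
      by rewrite def_x invmE // !inE Px -def_x Rgam.
    split.
      rewrite (eqEF _ _ _ gamma) //; last first.
        by move=> q Qq /=; rewrite R1q // iotaK.
      suffices <-: R = (iota @* R1)%G by [].
      exact/esym/val_inj.
    apply/setP=> r; apply/imsetP/idP=> [[q Qq ->] | /morphpreP[Pr /Rpre[q Qq def_r]]].
      exact: R1q.
    by exists q; rewrite //= -def_r invmE.
  have [[Px _] [Py _]] := (setIP NPx, setIP NPy).
  by apply: (injmP injI); rewrite // eq_xy ?Nx.
(* By [hJ], conjugation by x on Q becomes conjugation by [h (iota x)] on R; by [NIR] every element
   of N_I(R) arises in this way. *)
have AutPE a : a \in Aut Q ->
    (a \in AutP P Q) = (Theta a \in AutP I R).
  move=> Aa; have AThA : Theta a \in Aut R.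
    by rewrite -imThA mem_morphim.
  apply/AutPP/AutPP=> // -[x]; last first.
    rewrite -NIR => /imsetP[y NPy ->] def_a; exists y => // q Qq.
    apply: gaminj; rewrite ?Aut_closed ?nQx //= -hJ // -def_a ?Rgam //.
    by rewrite ThE.
  move=> NPx def_a; exists (h (iota x)); first by rewrite -NIR imset_f.
  by move=> _ /Rpre[q Qq ->]; rewrite ThE // hJ // def_a.
have sIA : AutP I R \subset AutP S R by rewrite morphimS // setSI.
have sTG : Theta @*^-1 AutP S R \subset GE.
  rewrite -(injmK injTh sGA) morphpreS //= imTh.
  exact: (pHall_sub sylR).
exists (Theta @*^-1 AutP S R)%G.
  rewrite -[AutE E Q]/(gval GE) -(injm_pHall injTh) ?subsetIl //=.
  rewrite imTh morphpreK // (subset_trans (pHall_sub sylR)) //.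
  by rewrite -imTh morphimS.
have sDA := subset_trans sDG sGA.
split=> // [|a g Da Gg /morphpreP[Aag /= TThag]].
  apply/subsetP=> a Da; have Aa := subsetP sDA a Da.
  by apply/morphpreP; split=> //=; apply: (subsetP sIA); rewrite -AutPE.
have [Aa Ag] := (subsetP sDA a Da, subsetP sGA g Gg).
(* Theta a is some c_x with x in I, whereas Theta (a^g) is so far only c_y with y in S. The task is
   to replace y by an element of I. *)
rewrite AutPE //; have AThag : Theta (a ^ g) \in Aut R.
  by rewrite -imThA mem_morphim.
have AThg : Theta g \in Aut R by rewrite -imThA mem_morphim.
have AThaR : Theta a \in Aut R by rewrite -imThA mem_morphim.
have [y NSy def_y] := AutPP _ AThag TThag.
have [x NIx def_x] : exists2 x, x \in 'N_I(R) & {in R, forall r, Theta a r = r ^ x}.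
  by apply/AutPP; rewrite -?AutPE.
have [Ix nRx] := setIP NIx.
have FThg : isoE F R R (Theta g).
  split; last first.
    apply/setP=> r; apply/imsetP/idP=> [[s Rs ->] | Rr].
      by rewrite Aut_closed.
    by exists ((Theta g)^-1 r); rewrite ?permKV // Aut_closed ?groupV.
  have: Theta g \in AutE F R by rewrite -imTh mem_morphim.
  by case/setIdP.
have gJ : {in R, forall r, Theta g (r ^ x) = Theta g r ^ y}.
  move=> r Rr; rewrite -def_x // -def_y ?Aut_closed //.
  by rewrite morphJ //= permJ.
(* Since Theta g conjugates c_x to c_y, it extends to an F-morphism k defined
   at x; then c_y = c_(k x), and k x lies in I as I is strongly closed. *)
have [k Fk def_k] := recR _ _ FThg.
have [kM _ _] := fhom_mono Fk.
have Nkx : x \in Nphi S R (Theta g).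
  rewrite inE inE (subsetP sIS') ?nRx //=; apply/exists_inP; exists y.
    by case: FThg => _ ->.
  by apply/forall_inP=> r Rr; rewrite gJ.
have kJ : {in R, forall r, Theta g r ^ k x = Theta g r ^ y}.
  move=> r Rr; rewrite -gJ // -!def_k ?memJ_norm //.
  apply/esym/(morphJ (Morphism kM)); last exact: Nkx.
  exact: (subsetP (sub_Nphi (proj1 FThg))).
have Rg r : r \in R -> exists2 s, s \in R & r = Theta g s.
  by exists ((Theta g)^-1 r); rewrite ?permKV // Aut_closed ?groupV.
apply/AutPP=> //; exists (k x).
  rewrite inE (strongly_closed_fhom scI Fk) //= inE.
  apply/subsetP=> _ /imsetP[_ /Rg[s Rs ->] ->].
  by rewrite kJ // memJ_norm ?Aut_closed //; case/setIP: NSy.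
by move=> _ /Rg[s Rs ->]; rewrite kJ // def_y ?Aut_closed.
Qed.

(** * Essential subgroups: centralizers and automorphisms with N_phi(Q) > Q *)

Section Essential.

Variables (gT : finGroupType) (P : {group gT}) (E : fusion_system P).
Implicit Types (Q R : {group gT}).

(** An isomorphism g from R to Q extends to N_g(R), which contains C_P(R). The extension h maps
    C_P(R) into C_P(Q) <= Q = h(R), and injectivity of h gives C_P(R) <= R. *)
Lemma receptive_centric Q :
  receptive E Q -> 'C_P(Q) \subset Q -> centricE E Q.
Proof.
move=> [sQP recQ] cQQ; split=> // R [f [Ef imf]].
have [EfR [g Eg fK]] := fhom_iso Ef imf.
have img : g @: R = Q.
  apply/setP=> q; apply/imsetP/idP=> [[s Rs ->] | Qq].
    by move: Rs; rewrite -{1}imf => /imsetP[q' Qq' ->]; rewrite fK.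
  by exists (f q); rewrite ?fK // -imf imset_f.
have [h Eh def_h] := recQ _ _ (conj Eg img).
have [hM hI hP] := fhom_mono Eh.
have [sRN sCN] := (sub_Nphi Eg, centP_sub_Nphi P R g).
apply/subsetP=> x CRx; have Nx := subsetP sCN x CRx; have [Px cRx] := setIP CRx.
have: h x \in Q.
  apply: (subsetP cQQ); rewrite inE (subsetP hP) ?imset_f //=.
  apply/centP=> q; rewrite -img => /imsetP[r Rr ->].
  rewrite -def_h // /commute -!hM // ?(subsetP sRN) //.
  by rewrite (centP cRx).
rewrite -img => /imsetP[r Rr]; rewrite -def_h // => /hI -> //.
exact: subsetP sRN r Rr.
Qed.

(** C_P(Q) lies in N_a(Q) for every a in Aut_E(Q). *)
Lemma essential_cent Q : Q \subset P -> essential E Q -> 'C_P(Q) \subset Q.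
Proof.
move=> sQP [_]; apply: contraTT => ncQ; rewrite properE negb_and negbK orbC.
apply/orP; left; apply/subsetP=> a AEa; apply: mem_gen; rewrite inE AEa /=.
have [_ Ea] := setIdP AEa.
rewrite properE (sub_Nphi Ea); apply: contra ncQ.
exact: subset_trans (centP_sub_Nphi _ _ _).
Qed.

(** Writing x = c_z and x^a = c_y puts z in N_a(Q), and z is outside Q since x is not inner. *)
Lemma Nphi_proper Q a x : Q \subset P -> a \in AutE E Q -> x \in AutP P Q ->
  x ^ a \in AutP P Q -> x \notin Inn Q -> Q \proper Nphi P Q a.
Proof.
move=> sQP /setIdP[Aa Ea] Dx Dxa notIx; rewrite properE (sub_Nphi Ea) /=.
have Ax := subsetP (Aut_conj_aut _ _) x Dx.
have Axa := subsetP (Aut_conj_aut _ _) _ Dxa.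
have [y NPy def_y] := AutPP _ Axa Dxa.
case/morphimP: Dx => z nQz NPz def_x.
apply: contra notIx => /subsetP/(_ z) sNQ; rewrite def_x mem_morphim // sNQ //.
rewrite inE NPz; apply/exists_inP; exists y.
  suffices ->: a @: Q = Q by [].
  apply/setP=> r; apply/imsetP/idP=> [[s Rs ->] | Rr].
    by rewrite Aut_closed.
  by exists (a^-1 r); rewrite ?permKV // Aut_closed ?groupV.
apply/forall_inP=> q Qq.
by rewrite -(norm_conj_autE nQz Qq) -def_x -def_y ?Aut_closed // permJ.
Qed.

End Essential.

Theorem proposition3p21 (gT : finGroupType) (p : nat) (P : {group gT})
    (E : fusion_system P) (Q : {group gT}) :
  prime p -> p.-group P -> semisaturated p E ->
  Q \subset P -> fully_normalized E Q -> essential E Q ->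
  [/\ centricE E Q,
      strongly_embedded p (OutE E Q) (OutP P Q)
          <<[set phi in OutE E Q | OutP P Q :&: OutP P Q :^ phi != 1]>>
        /\ OutP P Q :&: 'O_p(OutE E Q) = 1
    & Inn Q = gcore (AutP P Q) (AutE E Q)].
Proof.
move=> _ pP ssE sQP fnQ essQ.
have cQ := essential_cent sQP essQ.
have [[prQP recQ _] prK] := essQ.
have [T sylT scT] := semisaturated_Sylow ssE fnQ.
pose G := Group (AutE_group_set E sQP).
pose N := [group of Inn Q]; pose D := [group of AutP P Q].
have nsNG : N <| G := Inn_normal E sQP.
have sND : N \subset D := Inn_sub_AutP sQP.
have [sDT sTG _] := scT; have sDG := AutP_sub E sQP.
have nNG := normal_norm nsNG.
(* Normalizers grow in the p-group P, so N_P(Q) > Q. An element of N_P(Q) inducing an inner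
   automorphism lies in C_P(Q) Q = Q. *)
have notDN : ~~ (D \subset N).
  have: Q \proper 'N_P(Q) by apply: nilpotent_proper_norm (pgroup_nil pP) prQP.
  rewrite properE => /andP[_]; apply: contra => /subsetP sDN.
  apply/subsetP=> x NPx; have [Px nQx] := setIP NPx.
  have /morphimP[y _ Qy eq_xy] : conj_aut Q x \in Inn Q by rewrite sDN ?mem_morphim.
  have /rcosetP[z] : x \in 'ker (conj_aut Q) :* y.
    by apply/rcoset_kerP; rewrite // (subsetP (normG Q)).
  rewrite ker_conj_aut => cz def_x; rewrite def_x groupM // (subsetP cQ) //.
  by rewrite inE cz -(groupMr z (subsetP sQP y Qy)) -def_x Px.
have ntD : D / N != 1 by rewrite -subG1 quotient_sub1 // (subset_trans sDG).
set K := <<_>> in prK.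
have memK a x : a \in G -> x \in D -> x ^ a \in D -> x \notin N -> a \in K.
  move=> Ga Dx Dxa notNx; apply: mem_gen; apply/setIdP; split=> //.
  exact: (@Nphi_proper _ _ E _ _ x).
have [d Dd notNd] := subsetPn notDN.
(* An inner automorphism a sends the fixed d in D outside N to d^a in D. With N <= K, properness of
   K survives the quotient by N. *)
have sNK : N \subset K.
  apply/subsetP=> a Na; have Da := subsetP sND a Na.
  by apply: (memK a d); rewrite ?groupJ // (subsetP sDG).
have nsNK : N <| [group of K] := @normalS _ G _ N sNK (proper_sub prK) nsNG.
have prH : <<[set phi in G / N | (D / N) :&: (D / N) :^ phi != 1]>> \proper G / N.
  apply: sub_proper_trans (_ : K / N \proper G / N); last first.
    by rewrite (quotient_proper nsNK nsNG).
  rewrite gen_subG; apply/subsetP=> _ /setIdP[/morphimP[a nNa Ga ->]].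
  rewrite -subG1 => /subsetPn[u /setIP[/morphimP[x nNx Dx ->] ]].
  case/imsetP=> _ /morphimP[y nNy Dy ->]; rewrite -morphJ // => eq_xy nt_x.
  apply: mem_quotient; apply: (memK a y) => //.
    have: y ^ a \in N :* x by apply/rcoset_kercosetP; rewrite ?groupJ.
    by case/rcosetP=> n Nn ->; rewrite groupM // (subsetP sND).
  apply: contra nt_x => Ny; rewrite eq_xy inE; apply/eqP/coset_id.
  by rewrite memJ_norm.
have sylTN : p.-Sylow(G / N) (T / N).
  exact: (@quotient_pHall p _ G N T (subset_trans sTG nNG) sylT).
have scTN : strongly_closed_in (D / N) (T / N) (G / N).
  exact: (@strongly_closed_quotient _ D T G N nsNG (subset_trans sND sDT) scT).
have [sembD trD] := strongly_embedded_gen sylTN scTN ntD prH.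
split=> //; first exact: receptive_centric.
(* For the other inclusion, the core is a normal p-subgroup of G inside D, so modulo N it lies in
   the intersection of D / N and O_p(G / N), which is trivial by [trD]. *)
change (gval N = gcore D G); apply/eqP; rewrite eqEsubset gcore_max //=.
pose C := (gcore_group D G)%G; have sCD : C \subset D := gcore_sub _ _.
have sCG := subset_trans sCD sDG.
have nsCG : C <| G by rewrite /normal sCG gcore_norm.
have pC : p.-group C.
  by rewrite (pgroupS sCD) // morphim_pgroup // (pgroupS (subsetIl _ _)).
change (C \subset N); rewrite -quotient_sub1 ?(subset_trans sCG) //.
rewrite -trD subsetI quotientS //=.
by apply: (@pcore_max p _ (G / N) (C / N)); rewrite ?quotient_pgroup ?quotient_normal.
Qed.
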